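(* Let $k\ge 2$ and $r\ge 1$ be integers with $r\le k$. Then $$\sum_{s\mid (k,r)}\binom{k/s}{r/s}\mu(s)\equiv 0\pmod{k},$$ where the sum is over all positive divisors $s$ of the greatest common divisor $(k,r)$.
   Context: $(k,r)$ denotes the greatest common divisor of $k$ and $r$, and $\mu$ the Möbius function. *)

(* Defs.v *)
From mathcomp Require Export all_boot all_order all_algebra.

Set Implicit Arguments.
Unset Strict Implicit.
Unset Printing Implicit Defensive.

Import GRing.Theory.

Definition squarefree (n : nat) : bool :=
  (0 < n) && all (fun p => ~~ (p ^ 2 %| n)) (primes n).

(* The Möbius function; [primes n] lists each prime divisor once. The value at
   [n = 0], outside its domain, is [0]. *)
Definition mobius (n : nat) : int :=
  if squarefree n then ((-1) ^+ size (primes n))%R else 0%R.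

(* Main.v *)
(** One prime [p] dividing [k] at a time. Modulo [p ^ v_p(k)] we have
    [(1 + X) ^ n = (1 + X ^ p) ^ (n / p)] whenever [v_p(n) = v_p(k)], so that
    [C(n, m)] is congruent to [C(n / p, m / p)] if [p] divides [m], and to [0]
    otherwise. Hence, since [mu(p * t) = - mu(t)] for [t] prime to [p], the
    terms [s = t] and [s = p * t] of the sum cancel if [p] divides [r], and each
    term vanishes otherwise. *)

Require Import Defs.
From mathcomp Require Import all_boot all_order all_algebra.
From mathcomp Require Import ring.

Set Implicit Arguments.
Unset Strict Implicit.
Unset Printing Implicit Defensive.

Import GRing.Theory.

Section PowerCongruence.

Local Open Scope ring_scope.

Variable R : comNzRingType.
Implicit Types x y z c : R.

(** The binomial expansion cut off after its linear term. At [n = 0] the truncated exponent [n.-1]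
    is harmless, as the factor [n%:R] vanishes. *)
Lemma exprD_first_order y z n :
  exists w, (y + z) ^+ n = y ^+ n + n%:R * y ^+ n.-1 * z + z ^+ 2 * w.
Proof.
elim: n => [|n [w IHn]]; first by exists 0; rewrite !expr0; ring.
rewrite exprS IHn; case: n {IHn} => [|n].
  by exists (y * w + z * w); rewrite !expr0 expr1; ring.
exists (n.+1%:R * y ^+ n + (y + z) * w).
by rewrite !succnK !exprS -[n.+2%:R]natr1; ring.
Qed.

(** Each further [p]-th power gains one factor [p]: for an error term [z = p ^ j.+1 * c], the linear
    term carries the coefficient [p], and [z ^+ 2] is divisible by [p ^ (2 * j.+1)], hence by
    [p ^ j.+2]. *)
Lemma expr_prime_power_congr (p j : nat) x y :
  (exists c, x = y + p%:R * c) ->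
  exists c, x ^+ (p ^ j) = y ^+ (p ^ j) + (p ^ j.+1)%:R * c.
Proof.
move=> xy; elim: j => [|j [c IHj]]; first by rewrite expn0 !expr1 expn1.
have [w Dw] := exprD_first_order (y ^+ (p ^ j)) ((p ^ j.+1)%:R * c) p.
rewrite expnSr !exprM IHj Dw.
exists ((y ^+ (p ^ j)) ^+ p.-1 * c + (p ^ j)%:R * c ^+ 2 * w).
by rewrite !expnS !natrM; ring.
Qed.

Lemma exprD1_prime_congr (p : nat) x :
  prime p -> exists c, (x + 1) ^+ p = x ^+ p + 1 + p%:R * c.
Proof.
move=> pr_p; rewrite exprD1n -(big_mkord predT (fun i => x ^+ i *+ 'C(p, i))).
rewrite big_nat_recr //= big_ltn ?prime_gt0 //= bin0 binn expr0 !mulr1n.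
exists (\sum_(1 <= i < p) x ^+ i *+ ('C(p, i) %/ p)).
rewrite mulr_sumr addrC addrA; congr (_ + _); rewrite big_nat_cond [RHS]big_nat_cond.
apply: eq_bigr => i /andP[/andP[i_gt0 i_lt_p] _].
rewrite mulr_natl -mulrnA divnK // prime_dvd_bin //.
by rewrite i_gt0.
Qed.

Lemma exprD1_congr (p n : nat) x : prime p -> (0 < n)%N -> (p %| n)%N ->
  exists c, (x + 1) ^+ n = (x ^+ p + 1) ^+ (n %/ p) + (p ^ logn p n)%:R * c.
Proof.
move=> pr_p n_gt0 p_n; have p_gt0 := prime_gt0 pr_p.
have a_gt0 : (0 < logn p n)%N by rewrite logn_gt0 mem_primes pr_p n_gt0.
have /dvdnP[m Dn] := pfactor_dvdnn p n.
case Da: (logn p n) a_gt0 Dn => [//|a] _ Dn.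
have [c Dc] := expr_prime_power_congr a (exprD1_prime_congr x pr_p).
have Dn': (n = p * (p ^ a * m))%N by rewrite Dn expnS; ring.
rewrite {2}Dn' mulKn // {1}Dn' !exprM.
(* The sum is the cofactor of [u - v] in [u ^+ m - v ^+ m], which carries the congruence from
   exponent [p ^ a] over to its [m]-th power. *)
exists (c * \sum_(i < m) ((x + 1) ^+ p ^+ (p ^ a)) ^+ (m.-1 - i)
                           * ((x ^+ p + 1) ^+ (p ^ a)) ^+ i).
rewrite -[LHS](subrK (((x ^+ p + 1) ^+ (p ^ a)) ^+ m)) addrC subrXX mulrA.
by congr (_ + _ * _); rewrite Dc addrC addKr.
Qed.

End PowerCongruence.

Lemma coef_XnD1_exp (p m r : nat) : 0 < p ->
  ((('X^p + 1 : {poly int}) ^+ m)`_r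
    = if (p %| r)%N then ('C(m, r %/ p))%:Z else 0)%R.
Proof.
move=> p_gt0; rewrite exprD1n coef_sum.
under eq_bigr => i _ do rewrite -exprM coefMn coefXn.
case: ifP => [/dvdnP[q ->]|ndvd].
  rewrite mulnK //; case: (ltnP q m.+1) => [lt_q|gt_q].
    rewrite (bigD1 (Ordinal lt_q)) //= big1 ?addr0 => [|i /negPf ne_i].
      by rewrite mulnC eqxx natz.
    by rewrite mulnC eqn_pmul2l // eq_sym -val_eqE /= in ne_i *; rewrite ne_i mul0rn.
  rewrite bin_small // big1 // => i _; rewrite mulnC eqn_pmul2l // gtn_eqF ?mul0rn //.
  exact: leq_trans (ltn_ord i) gt_q.
rewrite big1 // => i _; case: eqP => [Dr|_]; last by rewrite mul0rn.
by rewrite Dr dvdn_mulr in ndvd.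
Qed.

Lemma bin_prime_congr (p n m : nat) : prime p -> 0 < n -> p %| n ->
  ((p ^ logn p n)%N%:Z %|
     'C(n, m)%:Z - (if (p %| m)%N then ('C(n %/ p, m %/ p))%:Z else 0))%Z%R.
Proof.
move=> pr_p n_gt0 p_n.
have [c Dc] := exprD1_congr ('X : {poly int})%R pr_p n_gt0 p_n.
have := congr1 (fun q : {poly int} => q`_m)%R Dc.
(* Writing ['X] as ['X^1] lets [coef_XnD1_exp] read off the coefficients on both sides. *)
rewrite -[X in ((X + 1) ^+ n)%R]expr1 coefD.
rewrite !coef_XnD1_exp ?(prime_gt0 pr_p) // dvd1n !divn1 => ->.
by rewrite addrC addKr mulr_natl coefMn -mulr_natl natz dvdz_mulr.
Qed.

Lemma mobius_mul_prime (p t : nat) : prime p -> 0 < t ->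
  mobius (p * t) = (if (p %| t)%N then 0 else - mobius t)%R.
Proof.
move=> pr_p t_gt0; have p_gt0 := prime_gt0 pr_p.
rewrite /mobius /squarefree muln_gt0 p_gt0 t_gt0 /=.
have Dprimes : primes (p * t) =i p :: primes t.
  by move=> q; rewrite primesM // primes_prime // !inE.
rewrite (eq_all_r Dprimes) /=.
case: (boolP (p %| t)) => [/dvdnP[u ->]|p'_t].
  by rewrite mulnC -mulnA mulnn dvdn_mull.
have -> : size (primes (p * t)) = (size (primes t)).+1.
  apply: (@perm_size _ _ (p :: primes t)); apply: uniq_perm => //.
    exact: primes_uniq.
  by rewrite /= primes_uniq mem_primes (negPf p'_t) !andbF.
rewrite -mulnn dvdn_pmul2l // p'_t /= exprS mulN1r.
(* A prime [q] dividing [t] differs from [p], so [q ^ 2] is coprime to [p]. *)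
have -> : all (fun q => ~~ (q ^ 2 %| p * t)) (primes t)
        = all (fun q => ~~ (q ^ 2 %| t)) (primes t).
  apply: eq_in_all => q; rewrite mem_primes => /and3P[pr_q _ q_t].
  rewrite Gauss_dvdr // coprime_pexpl // prime_coprime // dvdn_prime2 //.
  by apply: contraNneq p'_t => <-.
by case: ifP; rewrite ?oppr0.
Qed.

(** If [p] divides [g], the divisors that are multiples of [p] are the [p * t] with [t] dividing
    [g %/ p]. Those with [p] dividing [t] drop out since [mobius (p * t) = 0]; the others pair with
    [s = t], with opposite sign. *)
Lemma sum_divisors_mobius_prime (p g : nat) (F : nat -> int) :
  prime p -> 0 < g ->
  (\sum_(s <- divisors g) F s * mobius s =
   \sum_(s <- divisors g | ~~ (p %| s)%N)
     (F s - if (p %| g)%N then F (p * s)%N else 0) * mobius s)%R.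
Proof.
move=> pr_p g_gt0; have p_gt0 := prime_gt0 pr_p.
rewrite (bigID (fun s => p %| s)) /= addrC.
case: (boolP (p %| g)) => [p_g|p'_g]; last first.
  under [RHS]eq_bigr do rewrite subr0.
  rewrite [X in (_ + X)%R]big1_seq ?addr0 // => s /andP[p_s].
  by rewrite -dvdn_divisors // => /(dvdn_trans p_s); rewrite (negPf p'_g).
under [RHS]eq_bigr do rewrite mulrBl.
rewrite sumrB; congr (_ + _)%R.
have gp_gt0 : 0 < g %/ p by rewrite divn_gt0 // dvdn_leq.
have multiples : perm_eq [seq s <- divisors g | p %| s]
                         [seq p * t | t <- divisors (g %/ p)].
  apply: uniq_perm; first exact/filter_uniq/divisors_uniq.
    rewrite map_inj_uniq ?divisors_uniq // => t u /eqP.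
    by rewrite eqn_pmul2l // => /eqP.
  move=> s; rewrite mem_filter -dvdn_divisors //; apply/andP/mapP => [[p_s s_g]|].
    exists (s %/ p); last by rewrite mulnC divnK.
    by rewrite -dvdn_divisors // dvdn_divRL // divnK.
  case=> t; rewrite -dvdn_divisors // dvdn_divRL // => tp_g ->.
  by rewrite dvdn_mulr // mulnC.
have coprimes : perm_eq [seq s <- divisors g | ~~ (p %| s)]
                        [seq s <- divisors (g %/ p) | ~~ (p %| s)].
  apply: uniq_perm; [exact/filter_uniq/divisors_uniq..|] => s.
  rewrite !mem_filter -!dvdn_divisors //; case p'_s: (p %| s) => //=.
  rewrite dvdn_divRL // Gauss_dvd ?p_g ?andbT //.
  by rewrite coprime_sym prime_coprime // p'_s.
rewrite -big_filter (perm_big _ multiples) /= big_map.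
rewrite -[in RHS]big_filter (perm_big _ coprimes) /= big_filter.
rewrite -sumrN [RHS]big_mkcond /=; apply: eq_big_seq => t.
rewrite -dvdn_divisors // => t_gp; rewrite mobius_mul_prime ?(dvdn_gt0 _ t_gp) //.
by case: (p %| t); rewrite /= ?mulr0 ?mulrN.
Qed.

Theorem corollary1 (k r : nat) (hk : 2 <= k) (hr : 1 <= r) (hrk : r <= k) :
  (\sum_(s <- divisors (gcdn k r)) ('C(k %/ s, r %/ s))%:Z * mobius s = 0 %[mod k%:Z])%Z%R.
Proof.
have k_gt0 : 0 < k by apply: ltnW.
have g_gt0 : 0 < gcdn k r by rewrite gcdn_gt0 k_gt0.
apply/eqP; rewrite eqz_mod_dvd subr0 dvdzE /=.
(* It suffices to treat the exact power of each prime [p] dividing [k]. *)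
apply/(dvdn_partP _ k_gt0) => p; rewrite mem_primes => /and3P[pr_p _ p_k].
rewrite p_part -[p ^ _]/`|Posz (p ^ logn p k)|%N -dvdzE.
rewrite (sum_divisors_mobius_prime _ pr_p) // big_seq_cond.
apply: rpred_sum => s /andP[]; rewrite -dvdn_divisors // dvdn_gcd.
move=> /andP[s_k s_r] p'_s; apply: dvdz_mulr.
have cop_ps : coprime p s by rewrite prime_coprime.
have s_gt0 := dvdn_gt0 k_gt0 s_k.
have ks_gt0 : 0 < k %/ s by rewrite divn_gt0 // dvdn_leq.
have p_ks : p %| k %/ s by rewrite dvdn_divRL // Gauss_dvd // p_k.
have := bin_prime_congr (r %/ s) pr_p ks_gt0 p_ks.
(* As [p] does not divide [s], passing to [k %/ s] keeps the [p]-adic valuation, and [p] divides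
   [r %/ s] exactly when it divides [r], so both conditionals agree. *)
rewrite logn_div // (logn_coprime cop_ps) subn0 dvdn_gcd p_k /=.
by rewrite dvdn_divRL // Gauss_dvd // s_r andbT -!divnMA (mulnC p).
Qed.
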